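(* Let $n\geq 1$ and $d\geq 3$ be integers. The maximal TT rank of the $n$-dimensional order $d$ LCM tensor $A=[S_d]$ with $S=\{1,\ldots,n\}$, i.e. $A_{i_1,\ldots,i_d}=\operatorname{lcm}(i_1,\ldots,i_d)$ for $i_1,\ldots,i_d\in\{1,\ldots,n\}$, is given by $${\rm rank}_{\rm TT}A=\begin{cases} n&\text{if }d=3,\\ \#\{i_1\cdots i_{\lfloor d/2\rfloor }\mid 1\leq i_j\leq n\text{ and }\gcd(i_j,i_k)=1\text{ for all }j\neq k\}&\text{if }d>3.\end{cases}$$
   Context: For an $n$-dimensional tensor $A$ of order $d$ (array with entries $A_{i_1,\ldots,i_d}$, $i_1,\ldots,i_d\in\{1,\ldots,n\}$) and $1\leq k\leq d-1$, the unfolding matrix $A_{[k]}$ is the $n^k\times n^{d-k}$ matrix $$(A_{[k]})_{(i_1,\ldots,i_k),(i_{k+1},\ldots,i_d)}=A_{i_1,\ldots,i_d},$$ with rows enumerated by multi-indices $(i_1,\ldots,i_k)\in\{1,\ldots,n\}^k$ and columns by $(i_{k+1},\ldots,i_d)\in\{1,\ldots,n\}^{d-k}$. The maximal tensor-train (TT) rank of $A$ is $${\rm rank}_{\rm TT}A=\max_{1\leq k\leq d-1}{\rm rank}\,A_{[k]}.$$ In the claim, the set consists of integers (the values of the products, without multiplicity), the indices $i_1,\ldots,i_{\lfloor d/2\rfloor}$ range over integers, and $\#$ denotes cardinality. *)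

(* Defs.v *)
From HB Require Import structures.
From mathcomp Require Import all_boot all_order all_algebra finmap.

Set Implicit Arguments.
Unset Strict Implicit.
Unset Printing Implicit Defensive.

Local Open Scope ring_scope.

(* Multi-indices are tuples over 'I_n; the element i : 'I_n stands for the
   index i.+1 of {1, ..., n}. *)
Definition tensor (F : Type) (n d : nat) : Type := d.-tuple 'I_n -> F.

Section Unfolding.

Variables (F : Type) (n d : nat).

Definition join_index (k : 'I_d) (r : k.-tuple 'I_n)
    (c : (d - k).-tuple 'I_n) : d.-tuple 'I_n :=
  tcast (subnKC (ltnW (ltn_ord k))) (cat_tuple r c).

(* The dimensions are n ^ k and n ^ (d - k) by card_tuple; enum_val is the
   enumeration of the multi-indices. *)
Definition unfolding (A : tensor F n d) (k : 'I_d) :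
    'M[F]_(#|{: k.-tuple 'I_n}|, #|{: (d - k).-tuple 'I_n}|) :=
  \matrix_(r, c) A (join_index (enum_val r) (enum_val c)).

End Unfolding.

Definition tt_rank (F : fieldType) (n d : nat) (A : tensor F n d) : nat :=
  \max_(k < d | (0 < k)%N) \rank (unfolding A k).

Definition lcm_tensor (F : pzSemiRingType) (n d : nat) : tensor F n d :=
  fun t => (\big[lcmn/1%N]_(j < d) (tnth t j).+1)%:R.
Arguments lcm_tensor : clear implicits.

Definition pairwise_coprime (n m : nat) (t : m.-tuple 'I_n) : bool :=
  [forall j, forall k,
    (j != k) ==> (gcdn (tnth t j).+1 (tnth t k).+1 == 1%N)].

Definition coprime_products (n m : nat) : {fset nat} :=
  [fset (\prod_(j < m) (tnth (t : m.-tuple 'I_n) j).+1)%N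
    | t in {: m.-tuple 'I_n} & pairwise_coprime t]%fset.

(* Main.v *)
Require Import Defs.
From HB Require Import structures.
From mathcomp Require Import all_boot all_order all_algebra finmap.
From mathcomp Require Import ring zify.

Set Implicit Arguments.
Unset Strict Implicit.
Unset Printing Implicit Defensive.

Import Order.TTheory GRing.Theory Num.Theory.

(** Each unfolding of the LCM tensor is, up to repeated rows and columns, a
    matrix (lcm (x, y)) with x running over L_k and y over L_(d-k), where L_m is
    the set of lcms of m numbers between 1 and n.  Three facts about L_m drive
    the computation.

    - L_m is [coprime_products n m]: in an lcm of m numbers each prime power can
      be charged to a single number that attains it, which replaces the numbers
      by pairwise coprime divisors with the same lcm, now equal to their product
      ([coprime_refinement], [coprime_productsP]).
    - L_m is closed under divisors, since gcd distributes over lcm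
      ([coprime_products_dvd]).
    - L_k is contained in L_m when k <= m, by padding with ones
      ([coprime_products_sub]).

    For the rank, write lcm (x, y) = x y / gcd (x, y) and expand 1 / gcd (x, y)
    as the sum of c (e) over the common divisors e of x and y, where c is the
    Moebius inverse of m |-> 1 / m.  Explicitly e c (e) is the product of 1 - p
    over the primes p dividing e, so that c never vanishes.  As in Smith's
    treatment of gcd determinants, this factors the matrix (lcm (x, y)) through
    the smaller of the two sets, say S, as P^T D Q with D diagonal and
    invertible ([lcm_mx_factor]); closure under divisors guarantees that S
    contains all the e that are needed.  The columns of P indexed by S form a
    matrix triangular for divisibility, with nonzero diagonal, so P has full
    rank, and so does Q because S is contained in the other set.  The rank is
    therefore the size of S.

    Hence the k-th unfolding has rank #L_(min (k, d - k)), which is largest for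
    k = d / 2 rounded down.  For d = 3 this is #L_1 = n. *)

(** * Least common multiples as products of coprime factors *)

Lemma biglcmn_gt0 m (f : nat -> nat) :
  (forall j, 0 < f j) -> 0 < \big[lcmn/1]_(j < m) f j.
Proof.
by move=> f0; elim/big_ind: _ => // x y x0 y0; rewrite lcmn_gt0 x0.
Qed.

Lemma gcdn_biglcmn e m (f : nat -> nat) :
  gcdn e (\big[lcmn/1]_(j < m) f j) = \big[lcmn/1]_(j < m) gcdn e (f j).
Proof.
elim: m => [|m IHm]; first by rewrite !big_ord0 gcdn1.
by rewrite !big_ord_recr /= -IHm; exact: (@meetUr _ natdvd).
Qed.

Lemma biglcmn_coprime m (f : nat -> nat) :
  {in gtn m &, forall j k, j != k -> coprime (f j) (f k)} ->
  \big[lcmn/1]_(j < m) f j = \prod_(j < m) f j.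
Proof.
elim: m => [|m IHm] cop; first by rewrite !big_ord0.
rewrite !big_ord_recr /= IHm => [|j k jm km]; last first.
  by apply: cop; rewrite inE ltnW.
rewrite -muln_lcm_gcd; set P := \prod_(_ < m) _.
suff /eqP-> : coprime P (f m) by rewrite muln1.
rewrite /P; elim/big_ind: _ => [|x y cx cy|j _]; first exact: coprime1n.
  by rewrite coprimeMl cx.
by apply: cop; rewrite ?inE ?ltn_eqF // ltnW // ltnS.
Qed.

(** Each prime power of the lcm is taken from [y] when [y] contains strictly
    more of that prime, and from [x] otherwise. *)
Lemma lcmn_coprime_split x y : 0 < x -> 0 < y ->
  exists pi : nat_pred, lcmn x y = x`_pi^' * y`_pi.
Proof.
move=> x0 y0; exists [pred p | logn p x < logn p y]; set pi := [pred p | _].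
have l0 : 0 < lcmn x y by rewrite lcmn_gt0 x0.
rewrite -(partnC pi l0) mulnC; congr (_ * _).
  apply: eq_partn_from_log => // p /=; rewrite !inE -leqNgt => le_yx.
  by rewrite logn_lcm //; apply/maxn_idPl.
apply: eq_partn_from_log => // p /=; rewrite !inE => lt_xy.
by rewrite logn_lcm //; apply/maxn_idPr/ltnW.
Qed.

(** Induction on [m]: a new number takes over the primes that it contains to a
    strictly higher power than the lcm so far, and the older factors lose these
    primes, which keeps all factors pairwise coprime. *)
Lemma coprime_refinement m (f : nat -> nat) : (forall j, 0 < f j) ->
  exists g : nat -> nat, [/\ forall j, g j %| f j,
    {in gtn m &, forall j k, j != k -> coprime (g j) (g k)} &
    \prod_(j < m) g j = \big[lcmn/1]_(j < m) f j].
Proof.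
move=> f0; elim: m => [|m [g [gf cop eq_g]]].
  by exists f; split=> //; rewrite !big_ord0.
have [pi lcm_split] := lcmn_coprime_split (biglcmn_gt0 m f0) (f0 m).
have g0 j : 0 < g j := dvdn_gt0 (f0 j) (gf j).
(* The values at indices beyond m only have to divide those of f. *)
exists (fun j => if j < m then (g j)`_pi^' else (f j)`_pi); split.
- move=> j; case: ifP => _; last exact: dvdn_part.
  exact: dvdn_trans (dvdn_part _ _) (gf j).
- move=> j k; rewrite !inE !ltnS.
  case: (ltngtP j m) => // [jm|->] _; last first.
    by case: (ltngtP k m) => // _ _ _; exact: coprime_partC.
  case: (ltngtP k m) => // [km|->] _ jk; last first.
    by rewrite coprime_sym coprime_partC.
  apply: coprime_dvdl (dvdn_part _ _) _.
  by apply: coprime_dvdr (dvdn_part _ _) _; exact: cop.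
rewrite !big_ord_recr /= ltnn lcm_split -eq_g; congr (_ * _).
transitivity (\prod_(j < m) (g j)`_pi^').
  by apply: eq_bigr => j _; rewrite ltn_ord.
suff [] : 0 < \prod_(j < m) g j /\
    \prod_(j < m) (g j)`_pi^' = (\prod_(j < m) g j)`_pi^' by [].
elim/big_rec2: _ => [|j x y _ [x0 ->]]; first by rewrite partn1.
by rewrite partnM // muln_gt0 g0.
Qed.

(** * The set of lcms of m bounded numbers *)

(** The coprimality condition can be dropped at the price of replacing products
    by lcms.  Bounding [f] at every index, and not only below [m], makes padding
    and truncation immediate. *)
Lemma coprime_productsP n m x :
  reflect (exists2 f : nat -> nat,
             forall j, 0 < f j <= n.+1 & x = \big[lcmn/1]_(j < m) f j)
    (x \in coprime_products n.+1 m).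
Proof.
apply: (iffP (imfsetP _ _ _ _)) => [[t /= cop ->]|[f f_bd ->]].
  pose f j := (nth ord0 t j).+1; exists f => [j|]; first exact: ltn_ord.
  rewrite biglcmn_coprime => [|j k jm km jk].
    by apply: eq_bigr => j _; rewrite (tnth_nth ord0).
  have /forallP/(_ (Ordinal jm))/forallP/(_ (Ordinal km)) := cop.
  by rewrite -val_eqE /= jk !(tnth_nth ord0).
have f0 j : 0 < f j by have /andP[] := f_bd j.
have [g [gf cop <-]] := coprime_refinement m f0.
pose t := [tuple inord (g j).-1 : 'I_n.+1 | j < m].
have tE (j : 'I_m) : (tnth t j).+1 = g j.
  have g0 := dvdn_gt0 (f0 j) (gf j).
  rewrite tnth_mktuple inordK ?prednK //.
  by rewrite (leq_trans (dvdn_leq (f0 j) (gf j))) //; have /andP[] := f_bd j.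
exists t => [/=|]; last by apply: eq_bigr => j _; rewrite tE.
rewrite inE /=; apply/forallP => j; apply/forallP => k; apply/implyP => jk.
by rewrite !tE; apply: cop => //; exact: ltn_ord.
Qed.

Lemma biglcmn_tuple_coprime_products n m (t : m.-tuple 'I_n.+1) :
  \big[lcmn/1]_(j < m) (tnth t j).+1 \in coprime_products n.+1 m.
Proof.
apply/coprime_productsP; exists (fun j => (nth ord0 t j).+1) => [j|].
  exact: ltn_ord.
by apply: eq_bigr => j _; rewrite (tnth_nth ord0).
Qed.

Lemma coprime_products_tuple n m x : x \in coprime_products n.+1 m ->
  exists t : m.-tuple 'I_n.+1, x = \big[lcmn/1]_(j < m) (tnth t j).+1.
Proof.
case/coprime_productsP=> f f_bd ->.
exists [tuple inord (f j).-1 | j < m]; apply: eq_bigr => j _.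
by have /andP[f0 fn] := f_bd j; rewrite tnth_mktuple inordK prednK.
Qed.

Lemma coprime_products_gt0 n m x : x \in coprime_products n.+1 m -> 0 < x.
Proof.
case/coprime_productsP=> f f_bd ->.
by apply: biglcmn_gt0 => j; case/andP: (f_bd j).
Qed.

Lemma coprime_products_dvd n m x e :
  x \in coprime_products n.+1 m -> e %| x -> e \in coprime_products n.+1 m.
Proof.
case/coprime_productsP=> f f_bd -> /gcdn_idPl <-.
apply/coprime_productsP; exists (fun j => gcdn e (f j)) => [j|].
  have /andP[f0 fn] := f_bd j; rewrite gcdn_gt0 f0 orbT.
  exact: leq_trans (dvdn_leq f0 (dvdn_gcdr _ _)) fn.
exact: gcdn_biglcmn.
Qed.

Lemma coprime_products_sub n k m : k <= m ->
  {subset coprime_products n.+1 k <= coprime_products n.+1 m}.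
Proof.
move=> km x /coprime_productsP[f f_bd ->]; apply/coprime_productsP.
exists (fun j => if j < k then f j else 1) => [j|]; first by case: ifP.
rewrite (big_ord_widen _ _ km) big_mkcond /=.
by apply: eq_bigr => j _.
Qed.

Lemma card_coprime_products1 n : #|` coprime_products n.+1 1 |%fset = n.+1.
Proof.
rewrite -[RHS](size_iota 1); apply/perm_size/uniq_perm => [||x].
- exact: fset_uniq.
- exact: iota_uniq.
rewrite mem_iota; apply/coprime_productsP/idP => [[f f_bd ->]|x_bd].
  by rewrite big_ord_recl big_ord0 lcmn1.
by exists (fun=> x); rewrite // big_ord_recl big_ord0 lcmn1.
Qed.

(** * The Moebius inverse of the reciprocal *)

Section InverseGcd.

Local Open Scope ring_scope.

Variable F : numFieldType.

(** The closed form of the Moebius inverse of m |-> 1 / m; unlike a recursive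
    definition by inversion, it makes non-vanishing evident. *)
Definition inv_coef (e : nat) : F := (\prod_(p <- primes e) (1 - p%:R)) / e%:R.

Lemma inv_coef_neq0 e : (0 < e)%N -> inv_coef e != 0.
Proof.
move=> e0; rewrite mulf_neq0 ?invr_eq0 ?pnatr_eq0 -?lt0n //.
rewrite big_seq; elim/big_ind: _ => [|x y|p]; rewrite ?oner_eq0 //.
  exact: mulf_neq0.
by rewrite mem_primes subr_eq0 eq_sym pnatr_eq1 => /and3P[/prime_gt1/gtn_eqF->].
Qed.

Lemma inv_coefM p k e : prime p -> (0 < k)%N -> (0 < e)%N -> coprime p e ->
  inv_coef (p ^ k * e) = (1 - p%:R) / (p ^ k)%:R * inv_coef e.
Proof.
move=> p_pr k0 e0 cop; have p0 := prime_gt0 p_pr.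
have eq_pr : perm_eq (primes (p ^ k * e)) (p :: primes e).
  apply: uniq_perm => [||q]; rewrite ?primes_uniq //=.
    by rewrite primes_uniq mem_primes p_pr e0 -prime_coprime // cop.
  by rewrite primesM ?expn_gt0 ?p0 // primesX // primes_prime // inE in_cons.
by rewrite /inv_coef (perm_big _ eq_pr) big_cons natrM invfM mulrACA.
Qed.

(** A divisor of p^(k+1) q either divides p^k q or contains the full power
    p^(k+1). *)
Lemma perm_divisorsM_pfactor p k q : prime p -> (0 < q)%N -> coprime p q ->
  perm_eq (divisors (p ^ k.+1 * q))
    (divisors (p ^ k * q) ++ [seq (p ^ k.+1 * e)%N | e <- divisors q]).
Proof.
move=> p_pr q0 cop; have p0 := prime_gt0 p_pr.
have pX0 l : (0 < p ^ l)%N by rewrite expn_gt0 p0.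
have pXq0 l : (0 < p ^ l * q)%N by rewrite muln_gt0 pX0.
apply: uniq_perm => [||e]; first exact: divisors_uniq.
  rewrite cat_uniq divisors_uniq /= map_inj_uniq ?divisors_uniq => [|x y /eqP].
    rewrite andbT; apply/hasPn => _ /mapP[e _ ->] /=; rewrite -dvdn_divisors //.
    apply/negP => /(dvdn_trans (dvdn_mulr e (dvdnn _))).
    by rewrite Gauss_dvdl ?coprimeXl // dvdn_Pexp2l ?prime_gt1 // ltnn.
  by rewrite eqn_pmul2l // => /eqP.
rewrite mem_cat -!dvdn_divisors //.
apply/idP/orP => [e_m|[e_mp|/mapP[e' e'_q ->]]].
- have [r cop_r def_e] := pfactor_coprime p_pr (dvdn_gt0 (pXq0 _) e_m).
  have r_q : (r %| q)%N.
    rewrite -(@Gauss_dvdr _ (p ^ k.+1)); last by rewrite coprime_sym coprimeXl.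
    by apply: dvdn_trans e_m; rewrite def_e dvdn_mulr.
  have := dvdn_leq_log p (pXq0 _) e_m.
  rewrite lognM // pfactorK // (logn_coprime cop) addn0.
  rewrite leq_eqVlt => /orP[/eqP ek|lt_ek].
    right; apply/mapP; exists r; last by rewrite mulnC {1}def_e ek.
    by rewrite -dvdn_divisors.
  by left; rewrite def_e mulnC dvdn_mul // dvdn_exp2l.
- by apply: dvdn_trans e_mp _; rewrite dvdn_mul // dvdn_exp2l.
- by rewrite dvdn_mul // dvdn_divisors.
Qed.

(** Induction on [m] = p^(k+1) q: the divisors of p^k q contribute p / m, the
    others ((1 - p) / p^(k+1)) / q = (1 - p) / m, and these add up to 1 / m. *)
Lemma sum_inv_coef m : (0 < m)%N ->
  \sum_(e <- divisors m) inv_coef e = m%:R^-1.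
Proof.
elim/ltn_ind: m => m IHm m0; case: (ltngtP m 1) => [|m1|->].
- by case: m m0 {IHm}.
- have p_pr := pdiv_prime m1; set p := pdiv m in p_pr.
  have p0 := prime_gt0 p_pr; have p1 := prime_gt1 p_pr.
  have [q cop] := pfactor_coprime p_pr m0.
  have : (0 < logn p m)%N by rewrite logn_gt0 mem_primes p_pr m0 pdiv_dvd.
  case: (logn p m) => // k _; rewrite mulnC => def_m.
  have q0 : (0 < q)%N by move: m0; rewrite def_m muln_gt0 => /andP[].
  have pk0 : (0 < p ^ k)%N by rewrite expn_gt0 p0.
  have def_mp : m = (p * (p ^ k * q))%N by rewrite mulnA -expnS.
  rewrite def_m (perm_big _ (perm_divisorsM_pfactor _ p_pr q0 cop)).
  rewrite big_cat big_map /= IHm ?muln_gt0 ?pk0 //; last first.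
    by rewrite def_mp ltn_Pmull ?muln_gt0 ?pk0.
  rewrite (eq_big_seq (fun e => (1 - p%:R) / (p ^ k.+1)%:R * inv_coef e)).
    rewrite -mulr_sumr IHm //; last first.
      by rewrite def_m ltn_Pmull // -(exp1n k.+1) ltn_exp2r.
    have [pF pkF qF] :
        [/\ p%:R != 0 :> F, (p ^ k)%:R != 0 :> F & q%:R != 0 :> F].
      by rewrite !pnatr_eq0 -!lt0n.
    rewrite expnS !natrM; field.
    by rewrite pF pkF qF.
  move=> e; rewrite -dvdn_divisors // => e_q; apply: inv_coefM => //.
    exact: dvdn_gt0 e_q.
  exact: coprime_dvdr e_q cop.
- by rewrite big_seq1 /inv_coef big_nil divr1 invr1.
Qed.

End InverseGcd.

(** * The rank of a matrix of lcms *)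

Section LcmMatrix.

Local Open Scope ring_scope.

Variables (F : numFieldType) (S : seq nat).
Hypotheses (S_uniq : uniq S) (S_gt0 : {in S, forall x, (0 < x)%N}).
Hypothesis S_dvd : {in S, forall x e, (e %| x)%N -> e \in S}.

(** The incidence matrix of divisibility between [S] and the values of [f], with
    columns scaled by these values so as to absorb the factors x and y of
    x y / gcd (x, y). *)
Definition divides_mx p (f : 'I_p -> nat) : 'M[F]_(size S, p) :=
  \matrix_(x, i) ((nth 0 S x %| f i)%N%:R * (f i)%:R).

(** The columns whose values lie in [S] form a matrix that is triangular for
    divisibility, hence a vector of its left kernel vanishes by induction on the
    size of the element of [S] indexing its entry. *)
Lemma row_free_divides_mx p (f : 'I_p -> nat) :
  {in S, forall x, exists i, f i = x} -> row_free (divides_mx f).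
Proof.
move=> f_onto; apply: inj_row_free => v v0; apply/rowP => x; rewrite mxE.
have [N] := ubnP (nth 0%N S x); elim: N x => // N IHN x; rewrite ltnS => le_xN.
have x_S : nth 0%N S x \in S by rewrite mem_nth.
have [i fi] := f_onto _ x_S.
have /rowP/(_ i) := v0; rewrite !mxE (bigD1 x) //= big1 => [|y yx].
  rewrite mxE fi dvdnn mul1r addr0 => /eqP.
  by rewrite mulf_eq0 pnatr_eq0 (gtn_eqF (S_gt0 x_S)) orbF => /eqP.
rewrite mxE fi; have [dvd_yx|_] := boolP (_ %| _)%N; last first.
  by rewrite mul0r mulr0.
rewrite IHN ?mul0r // (leq_trans _ le_xN) // ltn_neqAle nth_uniq //.
by rewrite val_eqE yx dvdn_leq // S_gt0.
Qed.

(** A common divisor of [f i] and [g j] lies in [S] as a divisor of [f i], so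
    that the expansion of 1 / gcd (f i, g j) runs over elements of [S]. *)
Lemma lcm_mx_factor p q (f : 'I_p -> nat) (g : 'I_q -> nat) :
  (forall i, f i \in S) -> (forall j, 0 < g j)%N ->
  \matrix_(i, j) (lcmn (f i) (g j))%:R =
    (divides_mx f)^T *m diag_mx (\row_x inv_coef F (nth 0%N S x))
      *m divides_mx g.
Proof.
move=> f_S g0; apply/matrixP => i j; rewrite mul_mx_diag !mxE.
have fi0 := S_gt0 (f_S i).
have G0 : (0 < gcdn (f i) (g j))%N by rewrite gcdn_gt0 fi0.
have -> : (lcmn (f i) (g j))%:R =
    (f i)%:R * (g j)%:R * (gcdn (f i) (g j))%:R^-1 :> F.
  by rewrite -natrM -muln_lcm_gcd natrM mulfK // pnatr_eq0 -lt0n.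
rewrite -sum_inv_coef // mulr_sumr.
have eq_div : perm_eq (divisors (gcdn (f i) (g j)))
    [seq x <- S | (x %| f i) && (x %| g j)]%N.
  apply: uniq_perm => [||e]; rewrite ?divisors_uniq ?filter_uniq //.
  rewrite -dvdn_divisors // mem_filter dvdn_gcd.
  by case: (boolP (e %| f i)%N) => //= /(S_dvd (f_S i))->; rewrite andbT.
rewrite (perm_big _ eq_div) big_filter (big_nth 0%N) big_mkord big_mkcond.
apply: eq_bigr => x _; rewrite !mxE.
case: (_ %| f i)%N; case: (_ %| g j)%N; rewrite /= ?mul0r ?mulr0 ?mul1r //.
by rewrite -mulrA mulrAC -!mulrA; congr (_ * _); rewrite mulrC.
Qed.

Lemma rank_lcm_mx p q (f : 'I_p -> nat) (g : 'I_q -> nat) :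
  (forall i, f i \in S) -> {in S, forall x, exists i, f i = x} ->
  (forall j, 0 < g j)%N -> {in S, forall x, exists j, g j = x} ->
  \rank (\matrix_(i, j) (lcmn (f i) (g j))%:R : 'M[F]_(p, q)) = size S.
Proof.
move=> f_S f_onto g0 g_onto; rewrite lcm_mx_factor //.
rewrite mxrankMfree ?row_free_divides_mx // -mxrank_tr trmx_mul trmxK.
rewrite mxrankMfree ?row_free_divides_mx // mxrank_tr mxrank_unit //.
rewrite unitmxE det_diag unitfE; apply/prodf_neq0 => x _.
by rewrite mxE inv_coef_neq0 // S_gt0 // mem_nth.
Qed.

End LcmMatrix.

(** * The unfoldings of the LCM tensor *)

Section Unfoldings.

Local Open Scope ring_scope.

Lemma lcm_tensor_join (F : numFieldType) n d (k : 'I_d) (r : k.-tuple 'I_n) c :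
  lcm_tensor F n d (join_index r c) =
  (lcmn (\big[lcmn/1%N]_(j < k) (tnth r j).+1)
        (\big[lcmn/1%N]_(j < d - k) (tnth c j).+1))%:R.
Proof.
have seqE m (t : m.-tuple 'I_n) :
    \big[lcmn/1%N]_(j < m) (tnth t j).+1 = \big[lcmn/1%N]_(i <- t) i.+1.
  by rewrite big_tuple.
rewrite /lcm_tensor !seqE.
by rewrite val_tcast /= big_cat.
Qed.

(** The factorization goes through the smaller index set, so for k > d - k it is
    applied to the transposed unfolding. *)
Lemma rank_unfolding_lcm (F : numFieldType) n d (k : 'I_d) :
  \rank (unfolding (lcm_tensor F n.+1 d) k) =
  #|` coprime_products n.+1 (minn k (d - k)) |%fset.
Proof.
pose L m (t : m.-tuple 'I_n.+1) := \big[lcmn/1%N]_(j < m) (tnth t j).+1.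
pose f (i : 'I_#|{: k.-tuple 'I_n.+1}|) := L k (enum_val i).
pose g (j : 'I_#|{: (d - k).-tuple 'I_n.+1}|) := L (d - k)%N (enum_val j).
have onto m l : (l <= m)%N -> {in coprime_products n.+1 l, forall x,
    exists i : 'I_#|{: m.-tuple 'I_n.+1}|, L m (enum_val i) = x}.
  move=> lm x /(coprime_products_sub lm)/coprime_products_tuple[t ->].
  by exists (enum_rank t); rewrite enum_rankK.
have L_mem m t : L m t \in coprime_products n.+1 m.
  exact: biglcmn_tuple_coprime_products.
have L0 m t : (0 < L m t)%N := coprime_products_gt0 (L_mem m t).
have S0 m : {in coprime_products n.+1 m, forall x, (0 < x)%N}.
  by move=> x; exact: coprime_products_gt0.
have Sdvd m : {in coprime_products n.+1 m,
    forall x e, (e %| x)%N -> e \in coprime_products n.+1 m}.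
  by move=> x x_S e; exact: coprime_products_dvd.
have -> : unfolding (lcm_tensor F n.+1 d) k =
    \matrix_(i, j) (lcmn (f i) (g j))%:R.
  by apply/matrixP => i j; rewrite !mxE lcm_tensor_join.
have [le_k|/ltnW le_k] := leqP k (d - k).
  by apply: rank_lcm_mx => //; [exact: fset_uniq|exact: S0|exact: Sdvd|
    move=> i; exact: L_mem|exact: onto|move=> j; exact: L0|exact: onto].
rewrite -mxrank_tr.
have -> : (\matrix_(i, j) (lcmn (f i) (g j))%:R : 'M[F]_(_, _))^T =
    \matrix_(j, i) (lcmn (g j) (f i))%:R.
  by apply/matrixP => i j; rewrite !mxE lcmnC.
by apply: rank_lcm_mx => //; [exact: fset_uniq|exact: S0|exact: Sdvd|
    move=> i; exact: L_mem|exact: onto|move=> j; exact: L0|exact: onto].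
Qed.

End Unfoldings.

(** * The maximal rank *)

Theorem theorem4p4 (F : numFieldType) (n d : nat) (hn : (1 <= n)%N)
    (hd : (3 <= d)%N) :
  tt_rank (lcm_tensor F n d) =
  if d == 3 then n else #|` coprime_products n d./2 |%fset.
Proof.
case: n hn => // n _.
(* For d = 3 the general formula counts the products of a single number. *)
suff -> : tt_rank (lcm_tensor F n.+1 d) = #|` coprime_products n.+1 d./2 |%fset.
  by case: eqP => [->|//]; exact: card_coprime_products1.
have lt_half : (d./2 < d)%N by lia.
apply/eqP; rewrite eqn_leq; apply/andP; split.
  apply/bigmax_leqP => k _; rewrite rank_unfolding_lcm.
  by apply: fsubset_leq_card; apply/fsubsetP/coprime_products_sub; lia.
have -> : d./2 = minn (Ordinal lt_half) (d - Ordinal lt_half) by move=> /=; lia.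
rewrite -(rank_unfolding_lcm F).
by apply: (leq_bigmax_cond (Ordinal lt_half)) => /=; lia.
Qed.
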